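(* For every natural number $x$, $$S_{17}(2^{17} x) = 34\, S_{17}(2^9 x) - 17\, S_{17}(2x).$$
   Context: For $m, x \in \mathbb{N}$, the Newman sum is $S_m(x)=\sum_{0\le n<x,\ n\equiv 0 \pmod m} (-1)^{\sigma(n)}$, where $\sigma(n)$ denotes the number of 1's in the binary expansion of $n$. *)

(* Defs.v *)
From mathcomp Require Import all_boot all_order all_algebra.

Set Implicit Arguments.
Unset Strict Implicit.
Unset Printing Implicit Defensive.

Local Open Scope ring_scope.

(* The binary digit of n of weight 2 ^ i is odd (n %/ 2 ^ i); as n < 2 ^ n,
   all the digits of n at positions i >= n vanish. *)
Definition sigma (n : nat) : nat := (\sum_(i < n) odd (n %/ 2 ^ i))%N.

Definition newman_sum (m x : nat) : int :=
  \sum_(0 <= n < x | (m %| n)%N) (-1) ^+ sigma n.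

(* Main.v *)
(** Cut [0, 2^k x) into the dyadic blocks [2^k q, 2^k (q + 1)).  On such a block
    the signs factor as (-1)^sigma(q) (-1)^sigma(j) with 0 <= j < 2^k, so the
    block contributes (-1)^sigma(q) times a signed count depending on k and on
    2^k q modulo 17 only.  As 2^8 = 1 modulo 17, the three values k = 17, 9, 1
    give the same residue 2q, and the theorem reduces to a linear relation
    between signed counts for each of the 17 residues.  These counts satisfy a
    doubling recurrence in k, by which they are evaluated. *)

Require Import Defs.
From mathcomp Require Import all_boot all_order all_algebra.

Set Implicit Arguments.
Unset Strict Implicit.
Unset Printing Implicit Defensive.

Import GRing.Theory.

Local Open Scope ring_scope.

(** The number of digits summed in [sigma n] varies with [n]; digits past the leading one vanish, so
    any sufficient width [N] will do. This allows a split at position [k]. *)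
Lemma sigma_digits (n N : nat) :
  (n < 2 ^ N)%N -> sigma n = (\sum_(i < N) odd (n %/ 2 ^ i))%N.
Proof.
suff sum_ext a b : (n < 2 ^ a)%N -> (a <= b)%N ->
    (\sum_(i < a) odd (n %/ 2 ^ i) = \sum_(i < b) odd (n %/ 2 ^ i))%N.
  move=> ltnN; rewrite /sigma; have [le_nN | /ltnW le_Nn] := leqP n N.
    by apply: sum_ext => //; apply: ltn_expl.
  by apply/esym/sum_ext.
move=> ltna /subnKC <-; rewrite big_split_ord /= [X in (_ + X)%N]big1 ?addn0 //.
move=> i _; rewrite divn_small // (leq_trans ltna) //.
by rewrite leq_exp2l // leq_addr.
Qed.

Lemma sigma_block (k q j : nat) :
  (j < 2 ^ k)%N -> sigma (2 ^ k * q + j) = (sigma q + sigma j)%N.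
Proof.
move=> ltjk; have lt_q : (q < 2 ^ q)%N by apply: ltn_expl.
have lt_kq : (2 ^ k * q + j < 2 ^ (k + q))%N.
  apply: (@leq_trans (2 ^ k * q.+1)); first by rewrite mulnS addnC ltn_add2r.
  by rewrite expnD leq_mul2l lt_q orbT.
rewrite (sigma_digits lt_kq) (sigma_digits lt_q) (sigma_digits ltjk).
rewrite big_split_ord /= [LHS]addnC; congr addn; apply: eq_bigr => i _ /=.
  by rewrite expnD divnMA mulnC divnMDl ?expn_gt0 // (divn_small ltjk) addn0.
(* As [i < k], dividing the high part by [2 ^ i] leaves an even number, so digit [i] is that of
   [j]. *)
have -> : (2 ^ k * q = (2 ^ (k - i.+1) * q).*2 * 2 ^ i)%N.
  by rewrite -{1}(subnK (ltn_ord i)) expnD expnS -muln2 mulnAC !mulnA.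
by rewrite divnMDl ?expn_gt0 // oddD odd_double.
Qed.

Definition block_sum (m k r : nat) : int :=
  \sum_(0 <= j < 2 ^ k | (m %| r + j)%N) (-1) ^+ sigma j.

Lemma block_sum_modn (m k r : nat) : block_sum m k (r %% m) = block_sum m k r.
Proof. by apply: eq_bigl => j; rewrite /dvdn modnDml. Qed.

Lemma block_sum0 (m r : nat) : block_sum m 0 r = (m %| r)%N%:R.
Proof.
rewrite /block_sum big_mkcond big_nat1 addn0 /sigma big_ord0 expr0.
by case: ifP.
Qed.

Lemma sign_sum_block (m k r q : nat) :
  \sum_(2 ^ k * q <= n < 2 ^ k * q.+1 | (m %| r + n)%N) (-1) ^+ sigma n
    = (-1) ^+ sigma q * block_sum m k (r + 2 ^ k * q) :> int.
Proof.
rewrite -{1}[(2 ^ k * q)%N]add0n big_addn mulnS addnK /block_sum big_distrr /=.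
rewrite big_nat_cond [RHS]big_nat_cond.
apply: eq_big => [j | j /andP[/andP[_ ltj] _]].
  by rewrite -addnA [(j + _)%N]addnC.
by rewrite addnC sigma_block // exprD.
Qed.

(** The upper half of [[0, 2 ^ k.+1)] is the block [q = 1], whose sign is -1. *)
Lemma block_sumS (m k r : nat) :
  block_sum m k.+1 r = block_sum m k r - block_sum m k (r + 2 ^ k).
Proof.
have := sign_sum_block m k r 1; rewrite muln1 /(sigma 1) big_ord1 expr1 mulN1r.
move <-; rewrite {1}/block_sum (@big_cat_nat _ _ _ (2 ^ k)) ?leq_exp2l //=.
by rewrite mulnC -expnS.
Qed.

Lemma newman_sum_block (m k x : nat) :
  newman_sum m (2 ^ k * x)
    = \sum_(0 <= q < x) (-1) ^+ sigma q * block_sum m k (2 ^ k * q).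
Proof.
elim: x => [|x IHx]; first by rewrite muln0 /newman_sum !big_geq.
(* The added 0 is the shift [r] of [sign_sum_block]. *)
rewrite big_nat_recr //= -IHx -[(2 ^ k * x)%N in X in _ + X]add0n.
rewrite -sign_sum_block /newman_sum (@big_cat_nat _ _ _ (2 ^ k * x)) //=.
by rewrite leq_mul2l leqnSn orbT.
Qed.

(** Both terms of the doubling recurrence are read from one shared row of all residues, so
    evaluation takes [k * m] subtractions; plain unfolding would double the calls at each step. *)
Fixpoint block_row (m k : nat) : seq int :=
  if k is k'.+1 then
    let s := block_row m k' in
    mkseq (fun r => s`_r - s`_((r + 2 ^ k') %% m)) m
  else mkseq (fun r => (m %| r)%N%:R) m.

Lemma nth_block_row (m k r : nat) :
  (r < m)%N -> (block_row m k)`_r = block_sum m k r.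
Proof.
elim: k r => [|k IHk] r ltrm /=; rewrite nth_mkseq ?block_sum0 //.
have lt_mod : ((r + 2 ^ k) %% m < m)%N by rewrite ltn_mod (leq_trans _ ltrm).
by rewrite !IHk // block_sum_modn block_sumS.
Qed.

Lemma block_row17_rec (r : nat) :
  (r < 17)%N ->
  (block_row 17 17)`_r = 34 * (block_row 17 9)`_r - 17 * (block_row 17 1)`_r.
Proof.
(* The claim becomes a boolean test over the 17 residues, decided by computation. *)
rewrite -[(r < 17)%N](mem_iota 0 17) => r_iota; apply/eqP; move: r r_iota.
by apply/allP; vm_compute.
Qed.

Lemma block_sum17_rec (r : nat) :
  block_sum 17 17 r = 34 * block_sum 17 9 r - 17 * block_sum 17 1 r.
Proof.
have lt_r : (r %% 17 < 17)%N by rewrite ltn_mod.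
rewrite -!(block_sum_modn _ _ r) -!nth_block_row //.
exact: block_row17_rec.
Qed.

(** Indeed [2 ^ 8 = 15 * 17 + 1]. *)
Lemma exp2_period_mod17 (k : nat) : 2 ^ (8 + k) = 2 ^ k %[mod 17].
Proof. by rewrite expnD -modnMml mul1n. Qed.

Theorem theorem3 (x : nat) :
  newman_sum 17 (2 ^ 17 * x)%N
    = 34 * newman_sum 17 (2 ^ 9 * x)%N - 17 * newman_sum 17 (2 * x)%N.
Proof.
rewrite -[(2 * x)%N]/(2 ^ 1 * x)%N !newman_sum_block !big_distrr /= -sumrB.
apply: eq_bigr => q _.
have e9 : 2 ^ 9 * q = 2 ^ 1 * q %[mod 17].
  by rewrite -modnMml (exp2_period_mod17 1) modnMml.
have e17 : 2 ^ 17 * q = 2 ^ 1 * q %[mod 17].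
  by rewrite -modnMml (exp2_period_mod17 9) modnMml.
rewrite -(block_sum_modn _ 17) e17 -(block_sum_modn _ 9) e9 !block_sum_modn.
by rewrite block_sum17_rec mulrBr !mulrA ![(-1) ^+ _ * _]mulrC.
Qed.
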